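(* If a graph $H$ contains an induced cycle of length at least $5$, then the class of $H$-subdivisions does not have the induced Erdős–Pósa property.
   Context: All graphs are finite and simple. A subdivision of $H$ is a graph obtained from $H$ by repeatedly replacing an edge by a path of length $2$ through a new vertex. An induced subdivision of $H$ in $G$ is an induced subgraph of $G$ isomorphic to a subdivision of $H$. The class of $H$-subdivisions has the induced Erdős–Pósa property if there is a function $f:\mathbb N\to\mathbb R$ such that for every graph $G$ and every positive integer $k$, $G$ contains either $k$ pairwise vertex-disjoint induced subdivisions of $H$ or a set of at most $f(k)$ vertices meeting every induced subdivision of $H$. *)

(* Defs.v *)
From HB Require Import structures.
From mathcomp Require Import all_boot.
Set Implicit Arguments. Unset Strict Implicit. Unset Printing Implicit Defensive.

Record sgraph := SGraph {
  svert :> finType;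
  sadj : rel svert;
  sadj_sym : symmetric sadj;
  sadj_irr : irreflexive sadj }.
Arguments sadj : clear implicits.

Definition giso (G1 G2 : sgraph) : Prop :=
  exists f : G1 -> G2, bijective f /\ forall x y, sadj G2 (f x) (f y) = sadj G1 x y.

(* Subdividing the pair {u,v} of G: new vertex None adjacent exactly to u and v,
   the edge uv removed. Used below only when uv is an edge. *)
Section Subdivide.
Variables (G : sgraph) (u v : G).
Definition sub_adj (a b : option G) : bool :=
  match a, b with
  | Some x, Some y => sadj G x y && ~~ (((x == u) && (y == v)) || ((x == v) && (y == u)))
  | None, Some x => (x == u) || (x == v)
  | Some x, None => (x == u) || (x == v)
  | None, None => false
  end.
Lemma sub_adj_sym : symmetric sub_adj.
Proof.
case=> [x|] [y|] //=; rewrite sadj_sym; congr (_ && ~~ _).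
by rewrite orbC [(y == u) && _]andbC [(y == v) && _]andbC.
Qed.
Lemma sub_adj_irr : irreflexive sub_adj.
Proof. by case=> [x|] //=; rewrite sadj_irr. Qed.
Definition subdivide : sgraph := SGraph sub_adj_sym sub_adj_irr.
End Subdivide.

Inductive is_subdivision (H : sgraph) : sgraph -> Prop :=
| subdiv_iso G : giso H G -> is_subdivision H G
| subdiv_step (G : sgraph) (u v : G) G' :
    is_subdivision H G -> sadj G u v -> giso (subdivide u v) G' -> is_subdivision H G'.

Section Induced.
Variables (G : sgraph) (S : {set G}).
Definition ind_type : finType := {x : G | x \in S}.
Definition ind_adj (a b : ind_type) : bool := sadj G (val a) (val b).
Lemma ind_adj_sym : symmetric ind_adj.
Proof. by move=> a b; rewrite /ind_adj sadj_sym. Qed.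
Lemma ind_adj_irr : irreflexive ind_adj.
Proof. by move=> a; rewrite /ind_adj sadj_irr. Qed.
Definition induced : sgraph := SGraph ind_adj_sym ind_adj_irr.
End Induced.

Definition induces_subdivision (H G : sgraph) (S : {set G}) : Prop :=
  is_subdivision H (induced S).

(* The cycle C_n on 'I_n (a simple graph; a cycle for n >= 3). *)
Section Cycle.
Variable n : nat.
Definition cyc_adj (i j : 'I_n) : bool :=
  (i != j) && ((j == (i.+1 %% n) :> nat) || (i == (j.+1 %% n) :> nat)).
Lemma cyc_adj_sym : symmetric cyc_adj.
Proof. by move=> i j; rewrite /cyc_adj eq_sym orbC. Qed.
Lemma cyc_adj_irr : irreflexive cyc_adj.
Proof. by move=> i; rewrite /cyc_adj eqxx. Qed.
Definition cycle_graph : sgraph := SGraph cyc_adj_sym cyc_adj_irr.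
End Cycle.

Definition has_induced_long_cycle (H : sgraph) : Prop :=
  exists (C : {set H}) (n : nat), 5 <= n /\ giso (cycle_graph n) (induced C).

Definition induced_EP (H : sgraph) : Prop :=
  exists f : nat -> nat, forall (G : sgraph) (k : nat), 0 < k ->
    (exists F : 'I_k -> {set G},
        (forall i, induces_subdivision H (F i)) /\
        (forall i j, i != j -> [disjoint F i & F j]))
    \/
    (exists X : {set G}, #|X| <= f k /\
        forall S : {set G}, induces_subdivision H S -> ~~ [disjoint S & X]).

(* Main.v *)
Require Import Defs.
From mathcomp Require Import all_boot zify.
Set Implicit Arguments. Unset Strict Implicit. Unset Printing Implicit Defensive.

(** Fix a subdivision [B] of [H] in which every edge of [H] has become a long path on
    which every second vertex is a "gate".  Take [n] copies of [B] and identify gates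
    in pairs, so that for [e <> f] each path of copy [e] shares a gate with each path of
    copy [f]; then join completely the non-gates of distinct copies, and each non-gate
    to all gates foreign to its copy.  Gates stay pairwise nonadjacent.

    An induced cycle of length at least 5 is not a join and cannot afford a vertex
    adjacent to all its non-gates, so it lies inside one copy and contains a whole path
    of it.  An induced subdivision of [H] containing it has bounded degree, so it lies
    in the same copy, since foreign vertices see all the non-gates of that path.  Two
    subdivisions in distinct copies therefore share a gate; two disjoint ones in the
    same copy would double the maximal number of disjoint cycles, which subdivision
    does not change.  Each vertex is in at most two copies, so a set [X] misses one of
    the copies as soon as [n > 2 |X|]. *)

(** * Cores and holes *)

(** Cores stand in for cycles: in a graph the vertex set of a cycle is a core, and every core
    contains a cycle, so both have the same packing number. The relation is arbitrary so that edges
    can be deleted from a graph. *)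
Definition core (T : finType) (r : rel T) (A : {set T}) : Prop :=
  (exists x, x \in A) /\
  forall x, x \in A ->
    exists y z, [/\ y \in A, z \in A, y != z, r x y & r x z].

Lemma core_imset (T1 T2 : finType) (r1 : rel T1) (r2 : rel T2) (f : T1 -> T2) (A : {set T1}) :
  injective f -> (forall x y, r1 x y -> r2 (f x) (f y)) ->
  core r1 A -> core r2 (f @: A).
Proof.
move=> fI fr [[x0 Ax0] cA]; split; first by exists (f x0); apply: imset_f.
move=> _ /imsetP[x Ax ->]; have [y [z [Ay Az yz rxy rxz]]] := cA x Ax.
by exists (f y), (f z); rewrite !imset_f ?(inj_eq fI) ?fr.
Qed.

Lemma core_preimset (T1 T2 : finType) (r1 : rel T1) (r2 : rel T2) (f : T1 -> T2) (A : {set T2}) :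
  (forall y, y \in A -> exists x, y = f x) ->
  (forall x y, r2 (f x) (f y) -> r1 x y) ->
  core r2 A -> core r1 (f @^-1: A).
Proof.
move=> fA fr [[y0 Ay0] cA]; split.
  by have [x0 def_y0] := fA _ Ay0; exists x0; rewrite inE -def_y0.
move=> x; rewrite inE => /cA[y [z [Ay Az yz rxy rxz]]].
have [y' def_y] := fA _ Ay; have [z' def_z] := fA _ Az; subst y z.
exists y', z'; rewrite !inE Ay Az !fr //; split=> //.
by apply: contraNneq yz => ->.
Qed.

Lemma core_sub (T : finType) (r1 r2 : rel T) (A : {set T}) :
  (forall x y, x \in A -> y \in A -> r1 x y -> r2 x y) -> core r1 A -> core r2 A.
Proof.
move=> r12 [Ane cA]; split=> // x Ax; have [y [z [Ay Az yz xy xz]]] := cA x Ax.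
by exists y, z; rewrite !r12.
Qed.

(* Equivalently, [A] induces a nonempty disjoint union of cycles of length at least 5. *)
Definition hole (G : sgraph) (A : {set G}) : Prop :=
  [/\ exists x, x \in A,
      forall x, x \in A -> exists y z,
        [/\ y \in A, z \in A, y != z, sadj G x y & sadj G x z] /\
        (forall t, t \in A -> sadj G x t -> t = y \/ t = z),
      forall x y z, x \in A -> y \in A -> z \in A ->
        sadj G x y -> sadj G y z -> sadj G z x -> False
    & forall x y p q, x \in A -> y \in A -> p \in A -> q \in A -> x != y -> p != q ->
        sadj G x p -> sadj G p y -> sadj G y q -> sadj G q x -> False].

Lemma hole_core (G : sgraph) (A : {set G}) : hole A -> core (sadj G) A.
Proof.
by case=> Ane dA _ _; split=> // x /dA[y [z [h _]]]; exists y, z.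
Qed.

Lemma hole_imset (G1 G2 : sgraph) (f : G1 -> G2) (A : {set G1}) :
  injective f -> (forall x y, sadj G2 (f x) (f y) = sadj G1 x y) ->
  hole A -> hole (f @: A).
Proof.
move=> fI fE [[x0 Ax0] dA tA qA]; split.
- by exists (f x0); apply: imset_f.
- move=> _ /imsetP[x Ax ->]; have [y [z [[Ay Az yz xy xz] u]]] := dA x Ax.
  exists (f y), (f z); rewrite !imset_f // (inj_eq fI) !fE; split=> //.
  by move=> _ /imsetP[t At ->]; rewrite fE => /(u t At)[->|->]; [left|right].
- move=> _ _ _ /imsetP[x Ax ->] /imsetP[y Ay ->] /imsetP[z Az ->].
  by rewrite !fE; apply: tA.
- move=> _ _ _ _ /imsetP[x Ax ->] /imsetP[y Ay ->] /imsetP[p Ap ->] /imsetP[q Aq ->].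
  by rewrite !fE !(inj_eq fI); apply: qA.
Qed.

Lemma cycle_hole (n : nat) : 5 <= n -> @hole (cycle_graph n) [set: 'I_n].
Proof.
move=> n5.
have modS (i : 'I_n) : i.+1 %% n = if i.+1 == n then 0 else i.+1.
  case: eqP => [->|ne]; first by rewrite modnn.
  by rewrite modn_small // ltn_neqAle; apply/andP; split; [apply/eqP|].
(* Adjacency without remainders, which puts the axioms of a hole within reach of [lia]. *)
have adjE (i j : 'I_n) : cyc_adj i j =
    [|| j == i.+1 :> nat, i == j.+1 :> nat, (i == 0 :> nat) && (j.+1 == n)
      | (j == 0 :> nat) && (i.+1 == n)].
  have := ltn_ord i; have := ltn_ord j.
  rewrite /cyc_adj !modS -val_eqE /=; case: (i.+1 =P n); case: (j.+1 =P n); lia.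
have n_gt0 : 0 < n by lia.
pose o := Ordinal n_gt0.
split=> /=.
- by exists o; rewrite inE.
- move=> x _; have xn := ltn_ord x.
  have lt1 : (if x.+1 == n then 0 else x.+1) < n by case: (x.+1 =P n); lia.
  have lt2 : (if x == 0 :> nat then n.-1 else x.-1) < n by case: (x =P 0 :> nat); lia.
  exists (Ordinal lt1), (Ordinal lt2); rewrite !inE !adjE -!val_eqE /=.
  split; first by split=> //; case: (x.+1 =P n); case: (nat_of_ord x =P 0); lia.
  move=> t _; rewrite adjE; have tn := ltn_ord t => h.
  case: (nat_of_ord t =P (if x.+1 == n then 0 else x.+1)) => [e|ne].
    by left; apply: val_inj.
  right; apply: val_inj => /=; move: ne h.
  by case: (x.+1 =P n); case: (nat_of_ord x =P 0); lia.
- move=> x y z _ _ _; rewrite !adjE.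
  have := ltn_ord x; have := ltn_ord y; have := ltn_ord z; lia.
- move=> x y p q _ _ _ _; rewrite !adjE -!val_eqE /=.
  have := ltn_ord x; have := ltn_ord y; have := ltn_ord p; have := ltn_ord q; lia.
Qed.

(** * Cores and holes under the subdivision of one edge *)

Section SubdivideTransfer.
Variables (G : sgraph) (u v : G).
Hypothesis uv : sadj G u v.
Local Notation G' := (subdivide u v).

Let is_uv (x y : G) := ((x == u) && (y == v)) || ((x == v) && (y == u)).
(** The vertex that follows [x] along its edge to [y] after the subdivision. *)
Let redirect (x y : G) : G' := if is_uv x y then None else Some y.

(** The new vertex enters only together with both its neighbours, so cores stay cores and disjoint
    sets stay disjoint. *)
Definition sub_lift (A : {set G}) : {set G'} :=
  [set z : option G | if z is Some x then x \in A else (u \in A) && (v \in A)].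

Lemma sub_uv_neq : u != v.
Proof. by apply: contraTneq uv => ->; rewrite sadj_irr. Qed.

Let redirect_in (A : {set G}) x y : x \in A -> y \in A -> redirect x y \in sub_lift A.
Proof.
rewrite /redirect; case: ifP => [|_ _]; last by rewrite inE.
by case/orP=> /andP[/eqP-> /eqP->] Ax Ay; rewrite inE ?Ax ?Ay.
Qed.

Let redirect_adj x y : sadj G x y -> sadj G' (Some x) (redirect x y).
Proof.
rewrite /redirect /is_uv => xy; case: ifP => [|h] /=; last by rewrite xy h.
by case/orP=> /andP[-> _] //; rewrite orbT.
Qed.

Let redirect_inj x y z : y != z -> redirect x y != redirect x z.
Proof.
rewrite /redirect /is_uv; case: ifP => hy; case: ifP => hz //.
move=> yz; exfalso; move: yz sub_uv_neq.
case/orP: hy => /andP[/eqP ex /eqP->]; case/orP: hz => /andP[/eqP ex' /eqP->].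
all: by rewrite -?ex -?ex' ?eqxx.
Qed.

Lemma core_sub_lift (A : {set G}) : core (sadj G) A -> core (sadj G') (sub_lift A).
Proof.
move=> [[x0 Ax0] cA]; split; first by exists (Some x0); rewrite inE.
case=> [x|]; rewrite inE; [move=> Ax | case/andP=> Au Av].
  have [y [z [Ay Az yz xy xz]]] := cA x Ax.
  exists (redirect x y), (redirect x z).
  by rewrite !redirect_in // redirect_inj // !redirect_adj.
by exists (Some u), (Some v); rewrite !inE Au Av /= !eqxx orbT sub_uv_neq.
Qed.

(** A triangle through the new vertex would need the removed edge [uv]; a 4-cycle through it would
    come from a triangle on [u] and [v] in the old hole. *)
Lemma hole_sub_lift (A : {set G}) : hole A -> hole (sub_lift A).
Proof.
move=> hA; have [Ane cA'] := core_sub_lift (hole_core hA).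
case: hA => [_ dA tA qA]; split=> //.
- case=> [x|]; rewrite inE; [move=> Ax | case/andP=> Au Av]; last first.
    exists (Some u), (Some v); rewrite !inE Au Av /= !eqxx orbT sub_uv_neq.
    by split=> // -[t|//] _ /orP[]/eqP->; [left|right].
  have [y [z [[Ay Az yz xy xz] uniq]]] := dA x Ax.
  exists (redirect x y), (redirect x z).
  rewrite !redirect_in // redirect_inj // !redirect_adj //; split=> //.
  case=> [t|]; rewrite inE.
    move=> At /andP[xt nuv].
    by case: (uniq t At xt) => <-; [left|right]; rewrite /redirect /is_uv (negPf nuv).
  case/andP=> Au Av /orP[]/eqP def_x; subst x.
    by case: (uniq v Av uv) => <-; [left|right]; rewrite /redirect /is_uv !eqxx.
  have vu : sadj G v u by rewrite sadj_sym.
  by case: (uniq u Au vu) => <-; [left|right]; rewrite /redirect /is_uv !eqxx orbT.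
- have noN a b : ~~ [&& sub_adj u v None (Some a), sub_adj u v (Some a) (Some b)
                     & sub_adj u v (Some b) None].
    apply/negP => /and3P[/= ha /andP[ab ne] hb].
    by case/orP: ha ab ne => /eqP->; case/orP: hb => /eqP->;
      rewrite ?sadj_irr // !eqxx ?orbT.
  case=> [x|] [y|] [z|]; rewrite !inE //=.
  + move=> Ax Ay Az /andP[xy _] /andP[yz _] /andP[zx _]; exact: tA xy yz zx.
  + move=> Ax Ay _ xy yN xN; move: (noN x y); rewrite /= xN yN.
    by rewrite /= in xy; rewrite xy.
  + move=> Ax _ Az xN zN zx; move: (noN z x); rewrite /= xN zN.
    by rewrite /= in zx; rewrite zx.
  + move=> _ Ay Az yN yz zN; move: (noN y z); rewrite /= zN yN.
    by rewrite /= in yz; rewrite yz.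
- have noN x p q : x \in A -> (u \in A) && (v \in A) -> p != q ->
     sub_adj u v None (Some p) -> sub_adj u v None (Some q) ->
     sub_adj u v (Some p) (Some x) -> sub_adj u v (Some x) (Some q) -> False.
    move=> Ax /andP[Au Av] pq /= hp hq /andP[px _] /andP[xq _].
    have vu : sadj G v u by rewrite sadj_sym.
    case/orP: hp => /eqP ep; case/orP: hq => /eqP eq; subst p q;
      rewrite ?eqxx // in pq.
      exact: (tA u x v).
    exact: (tA v x u).
  case=> [x|] [y|] [p|] [q|]; rewrite ?inE //=.
  + move=> Ax Ay Ap Aq xy pq /andP[xp _] /andP[py _] /andP[yq _] /andP[qx _].
    exact: (qA x y p q).
  + move=> Ax Ay Ap uvA xy _ xp py yN xN; exact: (noN p x y).
  + move=> Ax Ay uvA Aq xy _ xN yN yq qx; apply: (noN q y x) => //.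
      by rewrite eq_sym.
  + move=> Ax uvA Ap Aq _ pq xp pN qN qx; apply: (noN x q p) => //.
      by rewrite eq_sym.
  + move=> uvA Ay Ap Aq _ pq pN py yq qN; exact: (noN y p q).
Qed.

(** If the new vertex lies in [A], so do its only neighbours [u] and [v], and each of them takes the
    other in its place. *)
Lemma core_sub_unlift (A : {set G'}) :
  core (sadj G') A -> core (sadj G) [set x | (Some x : G') \in A].
Proof.
move=> [[x0 Ax0] cA].
have nN (x : G) (y : G') : (Some x : G') \in A -> y \in A -> sadj G' (Some x) y ->
    exists2 y0, (Some y0 : G') \in A /\ sadj G x y0 & y = redirect x y0.
  move=> Ax; case: y => [y|] Ay /=.
    by case/andP=> xy ne; exists y; rewrite // /redirect /is_uv (negPf ne).
  move=> xN; have [y [z []]] := cA None Ay.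
  case: y z => [y|] [z|] // Ay' Az yz yN zN.
  rewrite /redirect /is_uv; have vu : sadj G v u by rewrite sadj_sym.
  have Auv : ((Some u : G') \in A) /\ ((Some v : G') \in A).
    by move: yz yN zN Ay' Az => /= yz /orP[]/eqP ey /orP[]/eqP ez;
      subst y z; rewrite ?eqxx // in yz *.
  case/orP: xN => /eqP->; first by exists v; [case: Auv | rewrite !eqxx].
  by exists u; [case: Auv | rewrite !eqxx orbT].
split.
  case: x0 Ax0 => [x|] Ax; first by exists x; rewrite inE.
  have [[y|] [z [Ay _ _]]] := cA None Ax; last by [].
  by exists y; rewrite inE.
move=> x; rewrite inE => Ax; have [y [z [Ay Az yz xy xz]]] := cA _ Ax.
have [y0 [Ay0 xy0] ey] := nN _ _ Ax Ay xy; have [z0 [Az0 xz0] ez] := nN _ _ Ax Az xz.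
exists y0, z0; rewrite !inE Ay0 Az0 xy0 xz0; split=> //.
by apply: contraNneq yz => e; rewrite ey ez e.
Qed.

Lemma sub_degree d : 2 <= d ->
  (forall x : G, #|[set y | sadj G x y]| <= d) ->
  forall x : G', #|[set y | sadj G' x y]| <= d.
Proof.
move=> d2 dG [x|]; last first.
  apply: leq_trans d2; apply: leq_trans (_ : #|[set Some u; Some v]| <= 2).
    by apply: subset_leq_card; apply/subsetP=> -[y|]; rewrite !inE.
  by rewrite cards2; case: eqP.
apply: leq_trans (dG x).
apply: leq_trans (leq_imset_card (redirect x) _); apply: subset_leq_card.
apply/subsetP=> -[y|]; rewrite inE /=.
  case/andP=> xy ne; apply/imsetP; exists y; first by rewrite inE.
  by rewrite /redirect /is_uv (negPf ne).
have vu : sadj G v u by rewrite sadj_sym.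
by case/orP=> /eqP->; apply/imsetP; [exists v | exists u];
  rewrite ?inE // /redirect /is_uv !eqxx ?orbT.
Qed.
End SubdivideTransfer.

(** * Disjoint cores, holes and degrees in subdivisions *)

Definition packs (G : sgraph) (r : nat) : Prop :=
  exists s : seq {set G},
    [/\ size s = r, pairwise (fun A B : {set G} => [disjoint A & B]) s
      & forall A, A \in s -> core (sadj G) A].

Lemma packs_map (G1 G2 : sgraph) (phi : {set G1} -> {set G2}) r :
  (forall A, core (sadj G1) A -> core (sadj G2) (phi A)) ->
  (forall A B : {set G1}, [disjoint A & B] -> [disjoint phi A & phi B]) ->
  packs G1 r -> packs G2 r.
Proof.
move=> phic phid [s [<- ds cs]]; exists (map phi s); split.
- by rewrite size_map.
- by rewrite pairwise_map; apply: sub_pairwise ds => A B; apply: phid.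
- by move=> _ /mapP[A As ->]; apply/phic/cs.
Qed.

Lemma packs_leq (G : sgraph) r : packs G r -> r <= #|G|.
Proof.
case=> s [<- ds cs]; apply: leq_trans (max_card (mem (\bigcup_(A <- s) A))).
elim: s ds cs => [|A s IH] //= /andP[dA ds] cs; rewrite big_cons.
have dAs : [disjoint A & \bigcup_(B <- s) B].
  elim: s dA {IH ds cs} => [|B s IH] /=; first by rewrite big_nil -setI_eq0 setI0.
  by case/andP=> dAB /IH dAs; rewrite big_cons -setI_eq0 setIUr setU_eq0 !setI_eq0 dAB.
rewrite cardsU disjoint_setI0 // cards0 subn0.
have A0 : 0 < #|A| by apply/card_gt0P; case: (cs A (mem_head _ _)).
by rewrite -add1n leq_add // IH // => B Bs; apply: cs; rewrite inE Bs orbT.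
Qed.

Lemma disjoint_imset (T1 T2 : finType) (f : T1 -> T2) (A B : {set T1}) :
  injective f -> [disjoint A & B] -> [disjoint f @: A & f @: B].
Proof.
by move=> fI; rewrite -!setI_eq0 => /eqP AB; rewrite -imsetI ?AB ?imset0 // => x y _ _; apply: fI.
Qed.

Lemma disjoint_preimset (T1 T2 : finType) (f : T1 -> T2) (A B : {set T2}) :
  [disjoint A & B] -> [disjoint f @^-1: A & f @^-1: B].
Proof. by rewrite -!setI_eq0 => /eqP AB; rewrite -preimsetI AB preimset0. Qed.

Lemma giso_packs (G1 G2 : sgraph) r : giso G1 G2 -> packs G1 r -> packs G2 r.
Proof.
case=> f [/bij_inj fI fE]; apply: (@packs_map _ _ (fun A => f @: A)) => [A|A B].
  2: exact: disjoint_imset.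
by apply: core_imset => // x y; rewrite fE.
Qed.

Lemma giso_sym (G1 G2 : sgraph) : giso G1 G2 -> giso G2 G1.
Proof.
case=> f [[g fK gK] fE]; exists g; split; first by exists f.
by move=> x y; rewrite -fE !gK.
Qed.

Lemma giso_refl (G : sgraph) : giso G G.
Proof. by exists id; split=> //; exists id. Qed.

(** Lifting a core and removing the new vertex both preserve cores and disjointness, so subdividing
    an edge leaves the packing number unchanged. *)
Lemma subdivision_packs (H G : sgraph) r : is_subdivision H G -> packs H r <-> packs G r.
Proof.
elim=> [{}G iso|{}G u v G' _ IH uv iso].
  by split; apply: giso_packs => //; apply: giso_sym.
apply: (iff_trans IH); split=> [|/(giso_packs (giso_sym iso))].
  move=> pG; apply: giso_packs iso _; apply: (@packs_map _ _ (sub_lift u v)) pG => [A|A B].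
    exact: core_sub_lift.
  rewrite -!setI_eq0 => /eqP/setP AB; apply/eqP/setP=> -[x|].
    by have := AB x; rewrite !inE.
  by have := AB u; rewrite !inE; do 4 case: (_ \in _).
apply: (@packs_map (subdivide u v) G (fun A => [set x | Some x \in A])) => [A|A B].
  exact: core_sub_unlift.
rewrite -!setI_eq0 => /eqP/setP AB; apply/eqP/setP=> x.
by have := AB (Some x); rewrite !inE.
Qed.

Lemma subdivision_hole (H G : sgraph) :
  is_subdivision H G -> (exists A : {set H}, hole A) -> exists A : {set G}, hole A.
Proof.
have iso_hole (G1 G2 : sgraph) : giso G1 G2 ->
    (exists A : {set G1}, hole A) -> exists A : {set G2}, hole A.
  case=> f [/bij_inj fI fE] [A hA].
  by exists (f @: A); apply: hole_imset.
elim=> [{}G iso|{}G u v G' _ IH uv iso hH]; first exact: iso_hole.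
apply: iso_hole iso _; have [A hA] := IH hH.
by exists (sub_lift u v A); apply: hole_sub_lift.
Qed.

Lemma subdivision_degree (H G : sgraph) d : 2 <= d -> #|H| <= d -> is_subdivision H G ->
  forall x : G, #|[set y | sadj G x y]| <= d.
Proof.
move=> d2 Hd.
have iso_deg (G1 G2 : sgraph) : giso G1 G2 ->
    (forall x : G1, #|[set y | sadj G1 x y]| <= d) ->
    forall x : G2, #|[set y | sadj G2 x y]| <= d.
  case=> f [[g fK gK] fE] dG x; apply: leq_trans (dG (g x)).
  rewrite -(card_imset _ (can_inj fK)); apply: subset_leq_card.
  apply/subsetP=> y; rewrite inE => xy; apply/imsetP; exists (g y); last by rewrite gK.
  by rewrite inE -fE !gK.
elim=> [{}G iso|{}G u v G' _ IH uv iso]; last by apply: iso_deg iso _; apply: sub_degree.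
by apply: iso_deg iso _ => x; apply: leq_trans Hd; apply: max_card.
Qed.

(** * Subdivisions with labelled paths *)

Section LabelledSubdivision.
Variables (H : sgraph) (K : finType).
Local Notation block := (H * H)%type.
Local Notation label := (block * (K * bool))%type.

Definition is_gate (o : option label) : bool := if o is Some l then l.2.2 else false.

(** Expresses that [A] runs through the whole path replacing the edge [i]. *)
Definition full_block (G : sgraph) (lab : G -> option label) (i : block) (A : {set G}) :=
  forall l : K * bool, exists2 b, b \in A & lab b = Some (i, l).

Definition minus (G : sgraph) (R : seq (G * G)) : rel G :=
  fun x y => [&& sadj G x y, (x, y) \notin R & (y, x) \notin R].

Local Notation img h R := [seq (h p.1, h p.2) | p : block <- R].

(* At most one vertex carries a given label, see [lab_inj]; the label [(i, (k, b))] is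
   that of a vertex on the path replacing the edge [i], and it is a gate if [b = true]. *)
Record labelling (R : seq block) (G : sgraph) (h : H -> G) (lab : G -> option label) : Prop := {
  lab_subdivision : is_subdivision H G;
  lab_emb_inj : injective h;
  lab_emb_None : forall a, lab (h a) = None;
  lab_inj : forall x x' l, lab x = Some l -> lab x' = Some l -> x = x';
  lab_gates : forall x x', sadj G x x' -> is_gate (lab x) -> is_gate (lab x') -> False;
  lab_edges : forall p, p \in R -> sadj G (h p.1) (h p.2);
  lab_fresh : forall x i l, lab x = Some (i, l) -> i \notin R }.

(* [R] is the set of edges of [H] not yet replaced by a labelled path. *)
Record outer_stage (R : seq block) (G : sgraph) (h : H -> G) (lab : G -> option label) : Prop := {
  outer_labelling : labelling R h lab;
  outer_core : forall A : {set G}, core (minus (img h R)) A -> exists i, full_block lab i A }.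

(* The edge [i] of [H] is being replaced by a path from [h i.1] to [h i.2];
   [y] is the last inner vertex created so far and [done] the list of labels in use. *)
Record inner_stage (R : seq block) (i : block) (done : seq (K * bool))
    (G : sgraph) (h : H -> G) (lab : G -> option label) (y : G) : Prop := {
  inner_labelling : labelling R h lab;
  inner_fresh : forall x l, lab x = Some (i, l) -> l \in done;
  inner_adj : sadj G y (h i.2);
  inner_notin : ((y, h i.2) \notin img h R) && ((h i.2, y) \notin img h R);
  inner_cur : forall A, core (sadj G) A -> y \in A -> h i.2 \in A ->
    forall l, l \in done -> exists2 b, b \in A & lab b = Some (i, l);
  inner_old : forall A : {set G}, core (minus ((y, h i.2) :: img h R)) A ->
    exists j, full_block lab j A }.

Definition lab_step (G : sgraph) (lab : G -> option label) (l : label) (z : option G) :=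
  if z is Some x then lab x else Some l.

(** The new vertex becomes the last one of the path, and the current edge now joins it to [h i.2].
    The last hypothesis keeps gates nonadjacent. *)
Lemma inner_step R i done G h lab y l :
  @inner_stage R i done G h lab y -> i \notin R -> l \notin done ->
  ~~ (l.2 && is_gate (lab y)) ->
  @inner_stage R i (l :: done) (subdivide y (h i.2)) (fun a => Some (h a))
    (lab_step lab (i, l)) None.
Proof.
case=> -[sG hI hN labI gates edges fresh] ifresh yv yvR cur old iR lD gy.
have SI : injective (fun p : G * G => (Some p.1, Some p.2)) by move=> [? ?] [? ?] [-> ->].
have imgS : img (fun a => Some (h a)) R = [seq (Some p.1, Some p.2) | p <- img h R].
  by rewrite -map_comp.
split.
- split=> /=.
  + exact: subdiv_step sG yv (giso_refl _).
  + by move=> a b [/hI].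
  + exact: hN.
  + case=> [x|] [x'|] m //=.
    * by move=> e e'; rewrite (labI _ _ _ e e').
    * by move=> e [e']; move: e lD; rewrite -e' => /ifresh ->.
    * by move=> [e] e'; move: e' lD; rewrite -e => /ifresh ->.
  + case=> [x|] [x'|] //=.
    * by case/andP=> xx' _; apply: gates xx'.
    * case/orP=> /eqP->; last by rewrite hN.
      by move=> g1 g2; rewrite g1 g2 in gy.
    * case/orP=> /eqP->; last by rewrite hN.
      by move=> g1 g2; rewrite g1 g2 in gy.
  + move=> p pR; rewrite (edges p pR) /=; apply/negP => e.
    case/andP: yvR => /negP n1 /negP n2.
    by case/orP: e => /andP[/eqP e1 /eqP e2]; [apply: n1 | apply: n2];
      rewrite -e1 -e2; apply/mapP; exists p.
  + by case=> [x|] j m /=; [apply: fresh | case=> <- _].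
- case=> [x|] m /=; first by rewrite inE => /ifresh->; rewrite orbT.
  by case=> ->; rewrite mem_head.
- by rewrite /= eqxx orbT.
- by apply/andP; split; apply/mapP=> -[].
- move=> A cA NA vA m; rewrite inE => /orP[/eqP->|mD]; first by exists None.
  (* A core through the new vertex contains both its neighbours, so [cur] applies once that vertex
     is removed. *)
  have yA : (Some y : subdivide y (h i.2)) \in A.
    have [[z|] [[w|] [Az Aw zw]]] := cA.2 None NA => //=.
    by move=> /orP[]/eqP ez /orP[]/eqP ew; subst z w; rewrite ?eqxx // in zw *.
  have [||b] := cur _ (core_sub_unlift yv cA) _ _ m mD; rewrite ?inE //.
  by move=> bA eb; exists (Some b).
- move=> A cA.
  (* Without its edge to [h i.2] the new vertex has one neighbour left, so no core contains it. *)
  have NA : None \notin A.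
    apply/negP=> NA; have [z [w [Az Aw zw]]] := cA.2 None NA.
    rewrite /minus !inE /= => /and3P[hz nz1 nz2] /and3P[hw nw1 nw2].
    case: z w zw hz nz1 nz2 hw nw1 nw2 {Az Aw} => [z|] [w|] // zw /=.
    move=> hz nz1 nz2 hw nw1 nw2.
    case/orP: hz => /eqP ez; subst z; last by rewrite eqxx in nz1.
    case/orP: hw => /eqP ew; subst w; last by rewrite eqxx in nw1.
    by rewrite eqxx in zw.
  have [|j fj] := old (Some @^-1: A).
  + apply: core_preimset cA => [[x|]|x x'].
    * by exists x.
    * by rewrite (negPf NA).
    * rewrite /minus !inE imgS => /and3P[/= /andP[xx' ne]].
      rewrite (mem_map SI _ (x, x')) (mem_map SI _ (x', x)) => n1 n2.
      rewrite xx' !negb_or n1 n2 !andbT !xpair_eqE /=.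
      by move: ne; rewrite negb_or [(x == h i.2) && _]andbC => /andP[-> ->].
  + by exists j => m; have [b bA eb] := fj m; exists (Some b); rewrite ?inE in bA *.
Qed.

Lemma inner_loop (ks : seq K) R i done G h lab y :
  @inner_stage R i done G h lab y -> i \notin R -> uniq ks ->
  (forall k b, k \in ks -> (k, b) \notin done) ->
  exists done' G' h' lab' y',
    [/\ @inner_stage R i done' G' h' lab' y', {subset done <= done'}
      & forall k b, k \in ks -> (k, b) \in done'].
Proof.
move=> st iR; elim: ks done G h lab y st => [|k ks IH] done G h lab y st.
  by move=> _ _; exists done, G, h, lab, y; split=> // k b; rewrite in_nil.
case/andP=> kks uks ksD.
(* First a non-gate, then a gate: gates take every second place on the path. *)
have st1 := @inner_step _ _ _ _ _ _ _ (k, false) st iR (ksD k false (mem_head _ _)) isT.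
have kD : (k, true) \notin (k, false) :: done.
  by rewrite inE negb_or ksD ?mem_head // xpair_eqE andbF.
have st2 := inner_step st1 iR kD isT.
have [||done' [G' [h' [lab' [y' [st' sD ks']]]]]] := IH _ _ _ _ _ st2 => //.
  move=> k' b k'ks; rewrite !inE !negb_or ksD ?inE ?k'ks ?orbT // !xpair_eqE.
  by have -> : (k' == k) = false by apply: contraNF kks => /eqP <-.
exists done', G', h', lab', y'; split=> //.
  by move=> l lD; apply: sD; rewrite !inE lD !orbT.
move=> k' b; rewrite inE => /orP[/eqP->|]; last exact: ks'.
by apply: sD; case: b; rewrite !inE eqxx ?orbT.
Qed.

(** A core containing both ends of the last edge of the finished path carries all labels of block
    [i]; any other core survives the deletion of that edge, and [inner_old] applies. *)
Lemma outer_step i R G h lab :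
  @outer_stage (i :: R) G h lab -> i \notin R -> (i.2, i.1) \notin R ->
  exists G' h' lab', @outer_stage R G' h' lab'.
Proof.
case=> -[sG hI hN labI gates edges fresh] old iR iR'.
have notR p : p \in R -> p \in i :: R by rewrite inE => ->; rewrite orbT.
have hhI : injective (fun p : block => (h p.1, h p.2)).
  by move=> [? ?] [? ?] [/hI-> /hI->].
(* The path starts as the bare edge [i], with no label in use. *)
have st : inner_stage R i [::] h lab (h i.1).
  split=> //.
  - split=> // [p /notR|x j l /fresh]; first exact: edges.
    by rewrite inE negb_or => /andP[].
  - by move=> x l /fresh; rewrite mem_head.
  - by apply: edges; rewrite mem_head.
  - apply/andP; split; first by rewrite (mem_map hhI R i).
    by rewrite (mem_map hhI R (i.2, i.1)).
have [done [G' [h' [lab' [y' [st' _ fullD]]]]]] :=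
  inner_loop st iR (enum_uniq K) (fun _ _ _ => isT).
have {}fullD l : l \in done by case: l => k b; apply: fullD; rewrite mem_enum.
exists G', h', lab'; case: st' => lab1 _ _ _ cur old'; split=> // A cA.
case: (boolP ((y' \in A) && (h' i.2 \in A))) => [/andP[yA vA]|nA].
  exists i => l; apply: cur => //; apply: core_sub cA => x x' _ _.
  by case/and3P.
apply: old'; apply: core_sub cA => x x' xA x'A /and3P[xx' n1 n2].
rewrite /minus xx' !inE !negb_or n1 n2 !andbT !xpair_eqE /=.
by apply/andP; split; apply: contra nA => /andP[/eqP<- /eqP<-]; rewrite ?xA ?x'A.
Qed.

Lemma outer_loop R G h lab :
  @outer_stage R G h lab -> uniq R -> (forall p, p \in R -> (p.2, p.1) \notin R) ->
  exists G' h' lab', @outer_stage [::] G' h' lab'.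
Proof.
elim: R G h lab => [|i R IH] G h lab st; first by exists G, h, lab.
case/andP=> iR uR asym.
have nR p : p \in i :: R -> (p.2, p.1) \notin R.
  by move/asym; rewrite inE negb_or => /andP[].
have [G' [h' [lab' st']]] := outer_step st iR (nR i (mem_head _ _)).
by apply: IH st' uR _ => p pR; apply: nR; rewrite inE pR orbT.
Qed.

Lemma labelled_subdivision :
  exists (B : sgraph) (lab : B -> option label),
  [/\ is_subdivision H B,
      forall x x' l, lab x = Some l -> lab x' = Some l -> x = x',
      forall x x', sadj B x x' -> is_gate (lab x) -> is_gate (lab x') -> False
    & forall A, core (sadj B) A -> exists i, full_block lab i A].
Proof.
(* Each edge of [H] once, directed by [enum_rank]. *)
pose R : seq block :=
  [seq p <- enum {: block} | sadj H p.1 p.2 && (enum_rank p.1 < enum_rank p.2)].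
have inR p : (p \in R) = sadj H p.1 p.2 && (enum_rank p.1 < enum_rank p.2).
  by rewrite mem_filter mem_enum andbT.
have [|||B [h [lab [[sB _ _ lI lg _ _] cB]]]] := @outer_loop R H id (fun=> None).
- split; first split=> //.
  + exact: subdiv_iso (giso_refl H).
  + by move=> p; rewrite inR => /andP[].
  (* At the start all edges are still to be replaced; deleting them leaves no core. *)
  + move=> A [[x xA] cA]; have [y [_ [_ _ _ + _]]] := cA x xA.
    have -> : img id R = R by rewrite -[RHS]map_id; apply: eq_map => -[].
    rewrite /minus !inR /= => /and3P[xy].
    rewrite xy sadj_sym xy /= -!leqNgt => le1 le2.
    have e : enum_rank x = enum_rank y by apply: val_inj; apply/eqP; rewrite eqn_leq le1 le2.
    by move: xy; rewrite (enum_rank_inj e) sadj_irr.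
- by rewrite filter_uniq ?enum_uniq.
- move=> p; rewrite !inR /= => /andP[_ lt]; rewrite negb_and; apply/orP; right.
  by rewrite -leqNgt ltnW.
exists B, lab; split=> // A cA; apply: cB; apply: core_sub cA => x y _ _ xy.
by rewrite /minus xy.
Qed.
End LabelledSubdivision.

(** * Gluing copies along gates *)

Lemma giso_trans (G1 G2 G3 : sgraph) : giso G1 G2 -> giso G2 G3 -> giso G1 G3.
Proof.
case=> f [fB fE] [g [gB gE]]; exists (g \o f); split; first exact: bij_comp.
by move=> x y; rewrite /= gE fE.
Qed.

Lemma subdivision_giso (H G G' : sgraph) :
  is_subdivision H G -> giso G G' -> is_subdivision H G'.
Proof.
case=> [{}G iso|{}G u v G1 sG uv iso] iso'.
  exact: subdiv_iso (giso_trans iso iso').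
exact: subdiv_step sG uv (giso_trans iso iso').
Qed.

Section Weave.
Variables (H : sgraph) (n : nat).
Local Notation E := (H * H)%type.
Local Notation K := ('I_n * E)%type.
Variables (B : sgraph) (lab : B -> option (E * (K * bool))).
Hypothesis labI : forall x x' l, lab x = Some l -> lab x' = Some l -> x = x'.
Hypothesis gatesN : forall x x', sadj B x x' -> is_gate (lab x) -> is_gate (lab x') -> False.

Definition gate (b : B) : bool := is_gate (lab b).
Definition private : finType := {b : B | ~~ gate b}.

(* The gate [(i, k)] of copy [e] is identified with the gate [(k.2, (e, i))] of copy
   [k.1] when [e != k.1]; when [e = k.1] it is not shared. The value [None] at unlabelled
   vertices is junk. *)
Definition glue (e : 'I_n) (b : B) : option (K * K) :=
  if lab b is Some (i, (k, _)) then
    Some (if e <= k.1 then ((e, i), k) else (k, (e, i)))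
  else None.

(** Left are the non-gates with their copies, right the gates after identification. Values on the
    right that no copy uses are extra gates, adjacent to all non-gates. *)
Definition wvert : finType := ('I_n * private + option (K * K))%type.

(* True when the gate [x] does not belong to copy [w.1]. *)
Definition wadj_gate (w : 'I_n * private) (x : option (K * K)) : bool :=
  [forall c, gate c && (glue w.1 c == x) ==> sadj B (val w.2) c].

Definition wadj (v w : wvert) : bool :=
  match v, w with
  | inl a, inl b => (a.1 != b.1) || sadj B (val a.2) (val b.2)
  | inl a, inr x => wadj_gate a x
  | inr x, inl a => wadj_gate a x
  | inr _, inr _ => false
  end.

Lemma wadj_sym : symmetric wadj.
Proof. by case=> [a|x] [b|y] //=; rewrite eq_sym sadj_sym. Qed.

Lemma wadj_irr : irreflexive wadj.
Proof. by case=> [a|x] //=; rewrite eqxx sadj_irr. Qed.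

Definition weave : sgraph := SGraph wadj_sym wadj_irr.

Definition copy (e : 'I_n) (b : B) : weave :=
  if insub b is Some p then inl (e, p) else inr (glue e b).

Lemma copy_private e (p : private) : copy e (val p) = inl (e, p).
Proof. by rewrite /copy valK. Qed.

Lemma copy_nongate e b (gb : ~~ gate b) : copy e b = inl (e, Sub b gb).
Proof. by rewrite /copy insubT. Qed.

Lemma copy_gate e b : gate b -> copy e b = inr (glue e b).
Proof. by move=> gb; rewrite /copy insubN // gb. Qed.

(** If the two pairs were ordered oppositely, one foreign index would be [e] itself, where [e <= e]
    settles the order. *)
Lemma glue_inj e b c : gate b -> gate c -> glue e b = glue e c -> b = c.
Proof.
rewrite /gate /is_gate /glue.
case eb: (lab b) => [[i [k []]]|] //; case ec: (lab c) => [[j [l []]]|] // _ _.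
case: ifP => le1; case: ifP => le2 [].
- by move=> e1 e2; apply: labI eb _; rewrite ec e1 e2.
- by move=> e1 e2; move: le2; rewrite -e1 /= leqnn.
- by move=> e1 e2; move: le1; rewrite e1 /= leqnn.
- by move=> e1 e2; apply: labI eb _; rewrite ec e1 e2.
Qed.

(** The gate that path [i] reserves for path [j] is the one reserved in return, so any two paths in
    distinct copies meet. *)
Lemma glue_shared e f b c i j : e != f ->
  lab b = Some (i, ((f, j), true)) -> lab c = Some (j, ((e, i), true)) ->
  glue e b = glue f c.
Proof.
move=> ef eb ec; rewrite /glue eb ec /=; case: (ltngtP e f) => // e_f.
by move: ef; rewrite -val_eqE /= e_f eqxx.
Qed.

Lemma wadj_gateE e (p : private) c :
  gate c -> wadj_gate (e, p) (glue e c) = sadj B (val p) c.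
Proof.
move=> gc; apply/forallP/idP => [/(_ c)|pc d]; first by rewrite /= gc eqxx.
by apply/implyP=> /andP[gd /eqP/(glue_inj gd gc)->].
Qed.

(** Gates are nonadjacent in [B] too, so gluing neither adds nor loses an edge inside a copy. *)
Lemma copy_adj e b c : sadj weave (copy e b) (copy e c) = sadj B b c.
Proof.
case: (boolP (gate b)) => gb; case: (boolP (gate c)) => gc.
- rewrite !copy_gate //=; apply/esym/negP => bc; exact: gatesN bc gb gc.
- by rewrite copy_gate // copy_nongate /= wadj_gateE // sadj_sym.
- by rewrite copy_nongate copy_gate //= wadj_gateE.
- by rewrite !copy_nongate /= eqxx.
Qed.

Lemma copy_inj e : injective (copy e).
Proof.
move=> b c; case: (boolP (gate b)) => gb; case: (boolP (gate c)) => gc.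
- by rewrite !copy_gate // => -[/glue_inj->].
- by rewrite copy_gate // copy_nongate.
- by rewrite copy_nongate copy_gate.
- by rewrite !copy_nongate => -[].
Qed.

Lemma copy_complete e w b :
  (forall c, w != copy e c) -> ~~ gate b -> sadj weave w (copy e b).
Proof.
move=> wN gb; rewrite copy_nongate.
case: w wN => [[f q]|x] wN /=.
  by rewrite (_ : f != e) //; apply: contra_neqN (wN (val q)) => /eqP->; rewrite copy_private.
apply/forallP=> c; apply/implyP=> /andP[gc /eqP ex].
by have := wN c; rewrite copy_gate // ex eqxx.
Qed.

(** * Holes and subdivisions of [H] in the glued graph *)

Lemma hole_in_copy (A : {set weave}) : hole A ->
  exists e, forall v, v \in A -> exists b, v = copy e b.
Proof.
case=> [[x0 Ax0] dA tA qA].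
have other x y : x \in A -> y \in A -> sadj weave x y ->
    exists z, [/\ z \in A, z != y, sadj weave x z
                & forall t, t \in A -> sadj weave x t -> t = y \/ t = z].
  move=> Ax Ay xy; have [p [q [[Ap Aq pq xp xq] u]]] := dA x Ax.
  case: (u y Ay xy) => ->; [exists q | exists p]; split=> //; first by rewrite eq_sym.
  by move=> t At /(u t At)[]; [right|left].
have sym x y : sadj weave x y -> sadj weave y x by rewrite sadj_sym.
(* Every non-gate is adjacent to one of the non-gates [w1], [w2] of distinct copies;
   hence on the path [c a w1 w2 b d] of the cycle, [c] and [d] are gates, and so is
   [a] or [b]. *)
have join e p f q : inl (e, p) \in A -> inl (f, q) \in A -> e = f.
  move=> Aw1 Aw2; case: (eqVneq e f) => // ef; exfalso.
  set w1 := inl _ in Aw1; set w2 := inl _ in Aw2.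
  have w12 : sadj weave w1 w2 by rewrite /= ef.
  have [a [Aa aw2 w1a u1]] := other _ _ Aw1 Aw2 w12.
  have [b [Ab bw1 w2b u2]] := other _ _ Aw2 Aw1 (sym _ _ w12).
  have [c [Ac cw1 ac _]] := other _ _ Aa Aw1 (sym _ _ w1a).
  have [d [Ad dw2 bd _]] := other _ _ Ab Aw2 (sym _ _ w2b).
  have aw2N : ~ sadj weave a w2.
    by move=> h; apply: (tA w1 a w2) => //; apply: sym.
  have bw1N : ~ sadj weave b w1.
    by move=> h; apply: (tA w1 w2 b).
  have abN : ~ sadj weave a b.
    move=> h; apply: (qA w1 b a w2) => //; [by rewrite eq_sym| |]; exact: sym.
  have key g r : inl (g, r) \in A ->
      [\/ inl (g, r) = w1, inl (g, r) = w2, inl (g, r) = a | inl (g, r) = b].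
    move=> Az; case: (eqVneq e g) => eg.
      have h : sadj weave w2 (inl (g, r)) by rewrite /= -eg eq_sym ef.
      by case: (u2 _ Az h) => ->; [constructor 1 | constructor 4].
    have h : sadj weave w1 (inl (g, r)) by rewrite /= eg.
    by case: (u1 _ Az h) => ->; [constructor 2 | constructor 3].
  have cX : exists x, c = inr x.
    case: c Ac cw1 ac => [[g r]|x]; last by exists x.
    move=> Ac cw1 ac; exfalso; case: (key _ _ Ac) => e1; rewrite e1 // in cw1 ac.
    - by rewrite eqxx in cw1.
    - by rewrite sadj_irr in ac.
  have dX : exists x, d = inr x.
    case: d Ad dw2 bd => [[g r]|x]; last by exists x.
    move=> Ad dw2 bd; exfalso; case: (key _ _ Ad) => e1; rewrite e1 // in dw2 bd.
    - by rewrite eqxx in dw2.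
    - exact: abN (sym _ _ bd).
    - by rewrite sadj_irr in bd.
  case: cX dX => x ex [y ey]; subst c d.
  (* Gates are pairwise nonadjacent, so [a] and [b] are non-gates. As [a] misses [w2] and [b] misses
     [a], both lie in copy [f], but then [b] sees [w1]. *)
  case: a Aa aw2 w1a u1 ac aw2N abN key {cw1} => [[g r]|//] Aa aw2 w1a u1 ac aw2N abN _.
  case: b Ab bw1 w2b u2 bd bw1N abN {dw2} => [[g' r']|//] Ab bw1 w2b u2 bd bw1N abN.
  case: (eqVneq g f) => gf; last by apply: aw2N; rewrite /= gf.
  case: (eqVneq g g') => gg'; last by apply: abN; rewrite /= gg'.
  by apply: bw1N; rewrite /= -gg' gf eq_sym ef.
have [e [p Aep]] : exists e p, inl (e, p) \in A.
  have [y [_ [[Ay _ _ xy _] _]]] := dA _ Ax0.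
  case: x0 Ax0 xy => [[e p]|x]; first by exists e, p.
  by case: y Ay => [[e p]|//] Ay; exists e, p.
exists e => -[[f q]|x] Av; first by exists (val q); rewrite copy_private (join _ _ _ _ Aep Av).
case: (boolP [exists c, gate c && (glue e c == x)]) => [/existsP[c /andP[gc /eqP<-]]|xN].
  by exists c; rewrite copy_gate.
(* A gate outside copy [e] sees every non-gate of the hole; walking along the hole from [x] then
   closes a triangle or a 4-cycle. *)
have full r : inl (e, r) \in A -> sadj weave (inr x) (inl (e, r)).
  move=> _; apply/forallP=> c; apply/implyP=> h; case/existsP: xN; by exists c.
have [y [_ [[Ay _ _ xy _] _]]] := dA _ Av.
case: y Ay xy => [[f r]|//] Ay xy.
have [z [Az zx yz _]] := other _ _ Ay Av (sym _ _ xy).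
case: z Az zx yz => [[g s]|z] Az zx yz.
  have eg := join _ _ _ _ Aep Az; subst g.
  by case: (tA _ _ _ Av Ay Az xy yz (sym _ _ (full _ Az))).
have [t [At ty zt _]] := other _ _ Az Ay (sym _ _ yz).
case: t At ty zt => [[g s]|//] At ty zt.
have eg := join _ _ _ _ Aep At; subst g.
by case: (qA _ _ _ _ Av Az Ay At _ _ xy yz zt (sym _ _ (full _ At))); rewrite eq_sym.
Qed.

Hypothesis coreB : forall A, core (sadj B) A -> exists i, full_block lab i A.
Hypothesis subB : is_subdivision H B.
Hypothesis holeH : exists A : {set H}, hole A.
Hypothesis n_large : #|H| + 2 < n.

Lemma subdivision_in_copy (S : {set weave}) : is_subdivision H (induced S) ->
  exists e, (forall v, v \in S -> exists b, v = copy e b) /\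
    exists i, forall l, exists2 b, copy e b \in S & lab b = Some (i, l).
Proof.
move=> sS; have [A hA] := subdivision_hole sS holeH.
pose T : {set weave} := [set val x | x in A].
have TS v : v \in T -> v \in S by case/imsetP=> x _ ->; apply: valP.
have hT : hole T by apply: hole_imset hA => //; apply: val_inj.
have [e eT] := hole_in_copy hT.
pose Tb := copy e @^-1: T.
have cTb : core (sadj B) Tb.
  by apply: core_preimset (hole_core hT) => // b c; rewrite copy_adj.
have [i fi] := coreB cTb.
exists e; split; last first.
  by exists i => l; have [b bT eb] := fi l; exists b => //; apply: TS; rewrite inE in bT.
move=> v vS; case: (boolP [exists b, v == copy e b]) => [/existsP[b /eqP->]|vN].
  by exists b.
have {}vN c : v != copy e c by apply: contraNN vN => h; apply/existsP; exists c.
pose w : induced S := Sub v vS.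
(* The summand 2 meets the requirement [2 <= d] of [subdivision_degree]. *)
have : #|[set y | sadj (induced S) w y]| <= #|H| + 2.
  by apply: subdivision_degree sS _; lia.
pose P := [set b in Tb | ~~ gate b].
have PN : #|P| <= #|[set y | sadj (induced S) w y]|.
  rewrite -(card_imset _ (@copy_inj e)).
  apply: leq_trans (leq_imset_card val _); apply: subset_leq_card.
  apply/subsetP=> _ /imsetP[b + ->]; rewrite !inE => /andP[/TS bS gb].
  apply/imsetP; exists (Sub (copy e b) bS) => //.
  by rewrite inE /= /ind_adj /=; apply: copy_complete.
(* Block [i] has a non-gate for each [k], hence at least [n] of them, all seen by the foreign
   vertex: too many for the degree bound. *)
have KP : #|{: K}| <= #|P|.
  have kI : injective (fun k : K => Some (i, (k, false))) by move=> k k' [].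
  rewrite -cardsT -(card_imset _ kI); apply: leq_trans (leq_imset_card lab _).
  apply: subset_leq_card; apply/subsetP=> _ /imsetP[k _ ->].
  have [b bT eb] := fi (k, false); apply/imsetP; exists b => //.
  by rewrite inE bT /gate eb.
have E0 : 0 < #|{: E}| by apply/card_gt0P; exists i.
have : n <= #|{: K}| by rewrite card_prod card_ord leq_pmulr.
lia.
Qed.

(** In distinct copies the two sets would share a gate. In the same copy each yields [r] cores of
    [B], which has the packing number of [H]. *)
Lemma packs_double (S1 S2 : {set weave}) r :
  is_subdivision H (induced S1) -> is_subdivision H (induced S2) ->
  [disjoint S1 & S2] -> packs H r -> packs H (r + r).
Proof.
move=> sS1 sS2 dS pH; apply/(subdivision_packs _ subB).
have [e [e1 [i fi]]] := subdivision_in_copy sS1.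
have [f [f2 [j fj]]] := subdivision_in_copy sS2.
case: (eqVneq e f) => [ef|ef]; last first.
  have [b bS eb] := fi ((f, j), true); have [c cS ec] := fj ((e, i), true).
  have gb : gate b by rewrite /gate eb.
  have gc : gate c by rewrite /gate ec.
  move: bS cS; rewrite !copy_gate // (glue_shared ef eb ec) => S1x S2x.
  by move: dS; rewrite -setI_eq0 => /eqP/setP/(_ (inr (glue f c))); rewrite !inE S1x S2x.
subst f.
have pull (S : {set weave}) : is_subdivision H (induced S) ->
    (forall v, v \in S -> exists b, v = copy e b) ->
    exists s : seq {set B}, [/\ size s = r, pairwise (fun A C : {set B} => [disjoint A & C]) s
      & forall A, A \in s -> core (sadj B) A /\ A \subset copy e @^-1: S].
  move=> sS eS; have [s [sz ds cs]] := (subdivision_packs r sS).1 pH.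
  pose phi (A : {set induced S}) : {set B} := copy e @^-1: [set val x | x in A].
  have valS (A : {set induced S}) v : v \in [set val x | x in A] -> v \in S.
    by case/imsetP=> x _ ->; apply: valP.
  exists (map phi s); split; first by rewrite size_map.
    rewrite pairwise_map; apply: sub_pairwise ds => A C dAC.
    by apply: disjoint_preimset; apply: disjoint_imset dAC; apply: val_inj.
  move=> _ /mapP[A As ->]; split.
    apply: core_preimset => [v /valS/eS //|b c|].
      by rewrite -(copy_adj e); apply.
    by apply: core_imset (cs A As) => //; apply: val_inj.
  by apply/subsetP=> b; rewrite !inE => /valS.
have [s1 [sz1 d1 c1]] := pull S1 sS1 e1; have [s2 [sz2 d2 c2]] := pull S2 sS2 f2.
exists (s1 ++ s2); split; first by rewrite size_cat sz1 sz2.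
  rewrite pairwise_cat d1 d2 !andbT; apply/allrelP=> A C As Cs.
  have [_ sA] := c1 A As; have [_ sC] := c2 C Cs.
  by apply: disjointWl sA _; apply: disjointWr sC _; apply: disjoint_preimset.
by move=> A; rewrite mem_cat => /orP[/c1[]|/c2[]].
Qed.

Lemma no_two_disjoint (S1 S2 : {set weave}) :
  is_subdivision H (induced S1) -> is_subdivision H (induced S2) -> ~~ [disjoint S1 & S2].
Proof.
move=> sS1 sS2; apply/negP=> dS.
(* A hole gives one core, and doubling is repeated until the cores outnumber the vertices of [H]. *)
have p2 j : packs H (2 ^ j).
  elim: j => [|j IH]; last by rewrite expnS mul2n -addnn; apply: packs_double dS IH.
  have [A hA] := holeH; exists [:: A]; split=> // C; rewrite inE => /eqP->.
  exact: hole_core.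
by have := packs_leq (p2 #|H|); rewrite leqNgt ltn_expl.
Qed.

(** A bound for the copies containing [v]: a glued gate can lie only in those named by its two
    halves. *)
Definition copies (v : weave) : {set 'I_n} :=
  match v with
  | inl w => [set w.1]
  | inr (Some (k, l)) => [set k.1; l.1]
  | inr None => set0
  end.

Lemma copies_copy e b : e \in copies (copy e b).
Proof.
case: (boolP (gate b)) => gb; last first.
  by rewrite copy_nongate !inE.
rewrite copy_gate //; move: gb; rewrite /gate /is_gate /glue.
by case: (lab b) => [[i [k _]]|//] _; case: ifP => _; rewrite !inE eqxx ?orbT.
Qed.

Lemma card_copies v : #|copies v| <= 2.
Proof.
case: v => [w|[[k l]|]] /=; rewrite ?cards1 ?cards0 //.
by rewrite cards2; case: (_ != _).
Qed.

Lemma copy_avoiding (X : {set weave}) : #|X| * 2 < n ->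
  exists2 S : {set weave}, is_subdivision H (induced S) & [disjoint S & X].
Proof.
(* Each vertex of [X] spoils at most two copies. *)
move=> Xn; have : ~~ ([set: 'I_n] \subset \bigcup_(v in X) copies v).
  apply: contraL Xn => /subset_leq_card; rewrite cardsT card_ord -leqNgt => /leq_trans-> //.
  rewrite -sum_nat_const; elim/big_rec2: _ => [|v U m _ IH]; first by rewrite cards0.
  by apply: leq_trans (leq_card_setU _ _) _; rewrite leq_add ?card_copies.
case/subsetPn=> e _ eN; exists [set copy e b | b in [set: B]].
  apply: subdivision_giso subB _.
  have inS b : copy e b \in [set copy e b | b in [set: B]] by apply: imset_f.
  exists (fun b => Sub (copy e b) (inS b)); split; last first.
    by move=> b c; rewrite /= /ind_adj /= -(copy_adj e).
  apply: inj_card_bij; first by move=> b c /(congr1 val) /= /copy_inj.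
  by rewrite card_sig card_imset ?cardsT //; apply: copy_inj.
rewrite -setI_eq0; apply/eqP/setP=> v; rewrite !inE; apply/negbTE/negP.
case/andP=> /imsetP[b _ ->] bX; case/bigcupP: eN; exists (copy e b) => //.
exact: copies_copy.
Qed.
End Weave.

(** * Choice of the number of copies, and conclusion *)

Theorem mainTheorem4 (H : sgraph) :
  has_induced_long_cycle H -> ~ induced_EP H.
Proof.
case=> C [m [m5 [g [/bij_inj gI gE]]]] [f hf].
have holeH : exists A : {set H}, hole A.
  exists [set val (g x) | x in [set: 'I_m]].
  apply: hole_imset (cycle_hole m5) => [|x y]; last exact: gE.
  by move=> x y /val_inj/gI.
(* More than [f 2 * 2], so that [X] misses a copy, and more than [#|H| + 2] for the degree argument;
   already [k = 2] fails. *)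
pose n := f 2 * 2 + #|H| + 3.
have [B [lab [subB labI gatesN coreB]]] := labelled_subdivision H ('I_n * (H * H))%type.
have n_large : #|H| + 2 < n by rewrite /n; lia.
have [[F [sF dF]]|[X [Xf hit]]] := hf (weave lab) 2 isT.
  have := @no_two_disjoint _ _ _ _ labI gatesN coreB subB holeH n_large
    _ _ (sF ord0) (sF ord_max).
  by rewrite dF.
have [|S sS dS] := copy_avoiding labI gatesN subB (X := X).
  apply: leq_ltn_trans (_ : f 2 * 2 < n); first by rewrite leq_mul2r Xf.
  by rewrite /n; lia.
by have := hit S sS; rewrite dS.
Qed.
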